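(* Let $(X,d)$ be a compact metric space and let $\psi$ be a continuous flow on $X$ which is ergodic with respect to a Borel probability measure $\mu$ on $X$ that is positive on every non-empty open set. Then every continuous Lyapunov function $h:X\to\mathbb{R}$ for $\psi$ is constant. In particular, $\psi$ is strongly chain transitive.
   Context: A continuous flow $\psi$ on $X$ preserving the Borel probability measure $\mu$ is ergodic with respect to $\mu$ in the usual sense; equivalently, for every $f\in C(X)$ and $g\in L^1(\mu)$, $$\lim_{T\to+\infty}\frac1T\int_0^T\Bigl(\int_X f(\psi_t(x))g(x)\,d\mu(x)\Bigr)dt=\int_X f\,d\mu\int_X g\,d\mu .$$ A function $h:X\to\mathbb{R}$ is a Lyapunov function for $\psi$ if $h\circ\psi_t\le h$ for every $t\ge0$. The flow $\psi$ is strongly chain transitive if for every $x,y\in X$, $\epsilon>0$, $T\ge0$ there is a finite sequence $(x_i,t_i)_{i=1,\dots,n}\subset X\times\mathbb{R}$ ($n\ge1$) with $t_i\ge T$ for all $i$, $x_1=x$ and, setting $x_{n+1}:=y$, $\sum_{i=1}^n d(\psi_{t_i}(x_i),x_{i+1})<\epsilon$. *)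

(* Defs.v *)
From HB Require Import structures.
From mathcomp Require Import all_boot all_order all_algebra.
From mathcomp Require Import all_classical all_reals all_analysis.

Set Implicit Arguments.
Unset Strict Implicit.
Unset Printing Implicit Defensive.

Import Order.TTheory GRing.Theory Num.Theory.
Import numFieldNormedType.Exports.

Local Open Scope classical_set_scope.
Local Open Scope ring_scope.

(* The measurable types of the library are pointed. The chosen point plays no
   role below: a space carrying a probability measure is non-empty anyway. *)
#[short(type="pmetricType")]
HB.structure Definition PMetric (K : numDomainType) :=
  {M of Pointed M & Metric K M}.

Definition borelType (R : realType) (X : pmetricType R) :=
  g_sigma_algebraType (@open X).

Section Flow.
Variables (R : realType) (X : pmetricType R).

Record is_continuous_flow (psi : R -> X -> X) : Prop := {
  flow_continuous : continuous (fun p : R * X => psi p.1 p.2) ;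
  flow0 : forall x, psi 0 x = x ;
  flowD : forall s t x, psi (s + t) x = psi s (psi t x) }.

Definition preserves (psi : R -> X -> X) (mu : probability (borelType X) R) :=
  forall (t : R) (A : set (borelType X)), measurable A ->
    mu (psi t @^-1` A) = mu A.

Definition ergodic (psi : R -> X -> X) (mu : probability (borelType X) R) :=
  preserves psi mu /\
  forall A : set (borelType X), measurable A ->
    (forall t : R, psi t @^-1` A = A) -> mu A = 0%E \/ mu A = 1%E.

Definition positive_on_opens (mu : probability (borelType X) R) :=
  forall U : set X, open U -> U !=set0 -> (0 < mu U)%E.

Definition lyapunov (psi : R -> X -> X) (h : X -> R) :=
  forall t : R, 0 <= t -> forall x, h (psi t x) <= h x.

(* Chains are indexed from 1; only the values x 1, ..., x n.+1 and
   t 1, ..., t n of the two sequences are constrained. *)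
Definition strongly_chain_transitive (psi : R -> X -> X) :=
  forall (x0 y0 : X) (eps T : R), 0 < eps -> 0 <= T ->
    exists (n : nat) (x : nat -> X) (t : nat -> R),
      [/\ (1 <= n)%N,
          forall i, (1 <= i <= n)%N -> T <= t i,
          x 1%N = x0, x n.+1 = y0 &
          \sum_(1 <= i < n.+1) mdist (psi (t i) (x i)) (x i.+1) < eps].

End Flow.

(* Main.v *)
Require Import Defs.
From mathcomp Require Import all_boot all_order all_algebra.
From mathcomp Require Import all_classical all_reals all_analysis.
From mathcomp Require Import lra.
Import Order.TTheory GRing.Theory Num.Theory.
Import numFieldNormedType.Exports.
Local Open Scope classical_set_scope.
Local Open Scope ring_scope.

(** A continuous function [h] that does not increase under a measure-preserving
    continuous map [f] is invariant: [{h < a}] is contained in its preimage by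
    [f], which has the same measure, so the open set of the points [x] with
    [h (f x) < a < h x] is null, hence empty. An [h] invariant under the whole
    flow is constant, since otherwise two disjoint non-empty open sets
    [{h < a}] and [{a < h}] would exist, the first one invariant. It is enough
    that [h] does not increase under [psi t] for all [t >= T].

    This applies to the infimum of the costs of the chains from [x0] to [y],
    as a function of [y]: it is 1-Lipschitz, and does not increase under
    [psi t] when [t >= T] because such a step can be appended to a chain at no
    cost. It vanishes at [psi T x0], hence everywhere. *)

Lemma open_measurable_borel {R : realType} {X : pmetricType R} (U : set X) :
  open U -> measurable (U : set (borelType X)).
Proof. by move=> oU; apply: sub_sigma_algebra. Qed.

Lemma open_sublevel {R : realType} {T : topologicalType} (h : T -> R) (a : R) :
  continuous h -> open [set x | h x < a].
Proof.
by move=> ch; apply: (@open_comp _ _ h [set r | r < a]) => //; exact: open_lt.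
Qed.

Lemma open_superlevel {R : realType} {T : topologicalType} (h : T -> R) (a : R) :
  continuous h -> open [set x | a < h x].
Proof.
by move=> ch; apply: (@open_comp _ _ h [set r | a < r]) => //; exact: open_gt.
Qed.

Lemma nonincreasing_invariant {R : realType} {X : pmetricType R}
    (mu : probability (borelType X) R) (f : X -> X) (h : X -> R) :
  positive_on_opens mu ->
  (forall A : set (borelType X), measurable A -> mu (f @^-1` A) = mu A) ->
  continuous f -> continuous h ->
  (forall x, h (f x) <= h x) -> forall x, h (f x) = h x.
Proof.
move=> mu_pos f_pres cf ch hf x; apply/eqP; rewrite eq_le hf /= leNgt.
apply/negP => lt_x.
pose a := (h (f x) + h x) / 2.
pose A : set (borelType X) := [set y | h y < a].
have oA : open (A : set X) by exact: open_sublevel.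
have ofA : open (f @^-1` A : set X) by apply: open_comp => // y _; exact: cf.
have mA : measurable A by exact: open_measurable_borel.
have mfA : measurable (f @^-1` A : set (borelType X)).
  exact: open_measurable_borel.
have oB : open [set y | a < h y] by exact: open_superlevel.
have oU : open (f @^-1` A `&` [set y | a < h y]) by exact: openI.
have /(mu_pos _ oU) : (f @^-1` A `&` [set y | a < h y]) !=set0.
  by exists x; split; rewrite /A /a /=; lra.
apply/negP; rewrite -leNgt.
have <- : mu (f @^-1` A `\` A) = 0%E.
  have := measureDI mu mfA mA.
  rewrite (setIidr (_ : A `<=` f @^-1` A)) => [|y]; last exact: le_lt_trans.
  rewrite [LHS](f_pres A mA).
  (* Both sides are extended reals; [mu A] can be cancelled because it is finite. *)
  move=> /(congr1 (fun z => z - mu A)%E).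
  rewrite addeK ?fin_num_measure// => <-.
  by rewrite subee ?fin_num_measure.
apply: le_measure; rewrite ?inE.
- exact: open_measurable_borel.
- exact: measurableD.
- by move=> y [? ay]; split => //; rewrite /A /=; apply/negP; rewrite -leNgt ltW.
Qed.

Lemma flow_time_continuous {R : realType} {X : pmetricType R} {psi : R -> X -> X}
  (t : R) : is_continuous_flow psi -> continuous (psi t).
Proof.
move=> [cpsi _ _] x.
exact: (@continuous2_cvg _ _ _ _ _ _ (fun=> t) id psi t x
  (cpsi (t, x)) (cvg_cst _) cvg_id).
Qed.

Lemma eventually_lyapunov_constant {R : realType} {X : pmetricType R}
    {psi : R -> X -> X} {mu : probability (borelType X) R} (T : R) (h : X -> R) :
  is_continuous_flow psi -> ergodic psi mu -> positive_on_opens mu ->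
  continuous h -> (forall t x, T <= t -> h (psi t x) <= h x) ->
  forall x y, h x = h y.
Proof.
move=> psi_flow [psi_pres psi_erg] mu_pos ch hT.
have h_late t x : T <= t -> h (psi t x) = h x.
  move=> Tt.
  exact: (nonincreasing_invariant mu (psi t) h mu_pos (psi_pres t)
            (flow_time_continuous t psi_flow) ch (fun y => hT t y Tt)).
(* Any [t], even negative, is the difference of the times [|T| + |t| + t] and [|T| + |t|], both at
   least [T]. *)
have h_inv t x : h (psi t x) = h x.
  rewrite -(h_late (`|T| + `|t|) (psi t x)); last first.
    by have := ler_norm T; have := normr_ge0 t; lra.
  rewrite -(flowD psi_flow) h_late//.
  by have := ler_norm T; have := ler_norm (- t); rewrite normrN; lra.
suff h_le x y : h x <= h y by move=> x y; apply/eqP; rewrite eq_le !h_le.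
rewrite leNgt; apply/negP => lt_yx.
pose a := (h y + h x) / 2.
pose A : set (borelType X) := [set z | h z < a].
have oA : open (A : set X) by exact: open_sublevel.
have oB : open [set z | a < h z] by exact: open_superlevel.
have mA : measurable A by exact: open_measurable_borel.
have /(mu_pos _ oA) muA : (A : set X) !=set0 by exists y; rewrite /A /a /=; lra.
have /(mu_pos _ oB) : [set z | a < h z] !=set0 by exists x; rewrite /a /=; lra.
apply/negP; rewrite -leNgt.
(* Measure 0 contradicts positivity on the open set [A]; measure 1 makes the complement null, and
   this contains [{a < h}]. *)
have [t|muA0|muA1] := psi_erg A mA.
- by apply/seteqP; split => z; rewrite /A /= h_inv.
- by rewrite muA0 ltxx in muA.
have <- : mu (~` A) = 0%E by rewrite probability_setC// muA1 subee.
apply: le_measure; rewrite ?inE.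
- exact: open_measurable_borel.
- exact: measurableC.
- by move=> z az; rewrite /A /=; apply/negP; rewrite -leNgt ltW.
Qed.

(** Strong chain transitivity amounts to these sets having infimum 0 for all end points and all
    [T >= 0]. *)
Definition chain_cost {R : realType} {X : pmetricType R} (psi : R -> X -> X)
    (T : R) (x0 y0 : X) : set R :=
  [set c | exists (n : nat) (x : nat -> X) (t : nat -> R),
    [/\ (1 <= n)%N,
        forall i, (1 <= i <= n)%N -> T <= t i,
        x 1%N = x0, x n.+1 = y0 &
        \sum_(1 <= i < n.+1) mdist (psi (t i) (x i)) (x i.+1) = c]].

Section ChainCost.
Context {R : realType} {X : pmetricType R} (psi : R -> X -> X) (T : R).
Implicit Types (x y : X) (t c : R).

Lemma chain_cost_ge0 x y c : chain_cost psi T x y c -> 0 <= c.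
Proof. by move=> [n [u [t [_ _ _ _ <-]]]]; apply: sumr_ge0 => i _; exact: mdist_ge0. Qed.

Lemma chain_cost1 x t : T <= t -> chain_cost psi T x (psi t x) 0.
Proof.
move=> Tt; exists 1%N, (fun i => if i == 1%N then x else psi t x), (fun=> t).
by split => //; rewrite big_nat1/= mdistxx.
Qed.

Lemma chain_cost_flow x y c t : T <= t ->
  chain_cost psi T x y c -> chain_cost psi T x (psi t y) c.
Proof.
move=> Tt [n [u [s [n1 Ts u1 un <-]]]].
(* The old end point [y], at index [n.+1], becomes the start of one more step, of duration [t],
   whose jump has length 0. *)
exists n.+1, (fun i => if i == n.+2 then psi t y else u i),
  (fun i => if i == n.+1 then t else s i); split => //.
- move=> i /andP[i1]; case: eqVneq => // ni le_i.
  by apply: Ts; rewrite i1 -ltnS ltn_neqAle ni.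
- by rewrite eqxx.
rewrite big_nat_recr//= !eqxx (ltn_eqF (ltnSn _)) un mdistxx addr0.
apply: eq_big_nat => i /andP[_ ni].
by rewrite !ltn_eqF// ltnW.
Qed.

(** Only the target of the last jump changes, so the triangle inequality bounds the extra cost. *)
Lemma chain_cost_move x y z c : chain_cost psi T x y c ->
  exists2 c', chain_cost psi T x z c' & c' <= c + mdist y z.
Proof.
case=> -[|n] [u [s [n1 Ts u1 un <-]]]; first by [].
pose v i := if i == n.+2 then z else u i.
exists (\sum_(1 <= i < n.+2) mdist (psi (s i) (v i)) (v i.+1)).
  by exists n.+1, v, s; split => //; rewrite /v eqxx.
rewrite !(big_nat_recr n.+1)//= -addrA lerD//.
  rewrite le_eqVlt; apply/orP; left; apply/eqP; apply: eq_big_nat => i /andP[_ ni].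
  by rewrite /v !ltn_eqF// ltnW.
by rewrite /v eqxx ltn_eqF// un metric_triangle.
Qed.

(** A single step reaches [psi T x], and its end can be moved to [y]. This guards against the
    default value of [inf] on the empty set. *)
Lemma chain_cost_nonempty x y : chain_cost psi T x y !=set0.
Proof.
have [c Cc _] := chain_cost_move _ _ y _ (chain_cost1 x T (lexx T)).
by exists c.
Qed.

Lemma chain_cost_inf_le x y c :
  chain_cost psi T x y c -> inf (chain_cost psi T x y) <= c.
Proof. by apply: ge_inf; exists 0 => r; exact: chain_cost_ge0. Qed.

Lemma chain_cost_inf_lipschitz x y z :
  inf (chain_cost psi T x z) <= inf (chain_cost psi T x y) + mdist y z.
Proof.
rewrite -lerBlDr; apply: lb_le_inf; first exact: chain_cost_nonempty.
move=> c /(chain_cost_move _ _ z)[c' /chain_cost_inf_le le_c' c'c].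
by rewrite lerBlDr (le_trans le_c').
Qed.

Lemma chain_cost_inf_continuous x :
  continuous (fun y => inf (chain_cost psi T x y)).
Proof.
move=> y; apply/cvgrPdist_lt => e e0.
near=> z.
have yz : mdist y z < e.
  have : ball y e z by near: z; exact: nbhsx_ballx.
  by rewrite ballEmdist.
(* The Lipschitz bound is one-sided; exchanging [y] and [z] controls the absolute value. *)
have := chain_cost_inf_lipschitz x y z.
have := chain_cost_inf_lipschitz x z y.
by rewrite (metric_sym z y) ltr_norml => ? ?; apply/andP; split; lra.
Unshelve. all: by end_near. Qed.

Lemma chain_cost_inf_flow x y t : T <= t ->
  inf (chain_cost psi T x (psi t y)) <= inf (chain_cost psi T x y).
Proof.
move=> Tt; apply: lb_le_inf; first exact: chain_cost_nonempty.
by move=> c Cc; apply: chain_cost_inf_le; exact: chain_cost_flow.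
Qed.

End ChainCost.

Theorem proposition3p6 (R : realType) (X : pmetricType R)
    (cX : compact [set: X])
    (psi : R -> X -> X) (psi_flow : is_continuous_flow psi)
    (mu : probability (borelType X) R)
    (psi_ergodic : ergodic psi mu) (mu_pos : positive_on_opens mu) :
  (forall h : X -> R, continuous h -> lyapunov psi h ->
     exists c : R, forall x, h x = c) /\
  strongly_chain_transitive psi.
Proof.
split=> [h ch h_lyap|x y eps T eps0 _].
  exists (h point) => x.
  apply: (eventually_lyapunov_constant 0 h psi_flow psi_ergodic mu_pos ch).
  by move=> t z t0; exact: h_lyap.
have Cxy : inf (chain_cost psi T x y) = inf (chain_cost psi T x (psi T x)).
  apply: (eventually_lyapunov_constant T (fun y => inf (chain_cost psi T x y))
            psi_flow psi_ergodic mu_pos).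
    exact: chain_cost_inf_continuous.
  by move=> t z; exact: chain_cost_inf_flow.
have : inf (chain_cost psi T x y) < eps.
  rewrite Cxy; apply: le_lt_trans eps0.
  by apply: chain_cost_inf_le; exact: chain_cost1.
(* The infimum need not be attained, but being below [eps] it leaves room for an actual chain of
   cost [c < eps]. *)
move=> /(inf_lt (chain_cost_nonempty _ _ _ _))[c [n [u [t [n1 Tt u1 un uc]]]] c_eps].
by exists n, u, t; split => //; rewrite uc.
Qed.
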